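(* An arbitrary $(n+2)$-dimensional solvable Leibniz algebra over $\mathbb{C}$ with nilradical $F_n^2$ is isomorphic to one of the following non-isomorphic algebras, each given in a basis $\{e_1,\dots,e_n,x,y\}$: $$L_1:\quad \begin{aligned} &[e_1,e_1]=e_3,\quad [e_i,e_1]=e_{i+1}\ (3\le i\le n-1),\\ &[e_1,x]=e_1,\quad [x,e_1]=-e_1,\quad [e_i,x]=(i-1)e_i\ (3\le i\le n),\\ &[e_2,y]=-[y,e_2]=e_2; \end{aligned}$$ $$L_2:\quad \begin{aligned} &[e_1,e_1]=e_3,\quad [e_i,e_1]=e_{i+1}\ (3\le i\le n-1),\\ &[e_1,x]=e_1,\quad [x,e_1]=-e_1,\quad [e_i,x]=(i-1)e_i\ (3\le i\le n),\\ &[e_2,y]=e_2. \end{aligned}$$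
   Context: All algebras are finite-dimensional over $\mathbb{C}$; in tables of multiplication, omitted products of basis elements are zero. A Leibniz algebra is a vector space $L$ with a bilinear bracket satisfying $[x,[y,z]]=[[x,y],z]-[[x,z],y]$ for all $x,y,z\in L$. Set $L^1=L$, $L^{k+1}=[L^k,L]$ and $L^{[1]}=L$, $L^{[s+1]}=[L^{[s]},L^{[s]}]$; $L$ is nilpotent if some $L^k=0$ and solvable if some $L^{[s]}=0$. The nilradical of $L$ is its maximal nilpotent (two-sided) ideal; ''with nilradical $F_n^2$'' means that the nilradical is isomorphic to $F_n^2$. The algebra $F_n^2$ is the $n$-dimensional Leibniz algebra with basis $\{e_1,\dots,e_n\}$ and products $[e_1,e_1]=e_3$ and $[e_i,e_1]=e_{i+1}$ for $3\le i\le n-1$. *)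

(* Defs.v *)
From HB Require Import structures.
From mathcomp Require Import all_boot all_order all_algebra.
From mathcomp Require Import ring zify.

Set Implicit Arguments.
Unset Strict Implicit.
Unset Printing Implicit Defensive.

Import GRing.Theory.
Local Open Scope ring_scope.

HB.mixin Record Vector_isLeibniz (K : fieldType) V of Vector K V := {
  bracket : V -> V -> V;
  bracket_linearl : forall v, linear (bracket^~ v);
  bracket_linearr : forall u, linear (bracket u);
  leibniz_identity : forall x y z : V,
    bracket x (bracket y z)
      = bracket (bracket x y) z - bracket (bracket x z) y
}.

#[short(type="leibnizType")]
HB.structure Definition Leibniz (K : fieldType) :=
  {V of Vector K V & Vector_isLeibniz K V}.

Section LeibnizTheory.
Variables (K : fieldType) (L : leibnizType K).
Implicit Types U V W N : {vspace L}.

(* As for prodv, bases suffice to span [U, V] by bilinearity. *)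
Definition bracketv U V : {vspace L} :=
  <<[seq bracket u v | u <- vbasis U, v <- vbasis V]>>%VS.

(* The series are indexed from 0: lower_central U k is U^(k+1) and
   derived_series U s is U^[s+1]. *)
Fixpoint lower_central U k : {vspace L} :=
  if k is k'.+1 then bracketv (lower_central U k') U else U.

Fixpoint derived_series U s : {vspace L} :=
  if s is s'.+1
  then bracketv (derived_series U s') (derived_series U s') else U.

Definition is_nilpotent U : Prop := exists k, lower_central U k = 0%VS.

Definition is_solvable U : Prop := exists s, derived_series U s = 0%VS.

Definition is_ideal U : Prop :=
  forall u v, u \in U -> bracket u v \in U /\ bracket v u \in U.

Definition is_nilradical N : Prop :=
  [/\ is_ideal N, is_nilpotent N
    & forall M, is_ideal M -> is_nilpotent M -> (N <= M)%VS -> M = N].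

End LeibnizTheory.

(* A is isomorphic to the subalgebra U of B. *)
Definition isomorphic_onto (K : fieldType) (A B : leibnizType K)
    (U : {vspace B}) : Prop :=
  exists f : 'Hom(A, B),
    [/\ lker f = 0%VS, limg f = U
      & forall u v, f (bracket u v) = bracket (f u) (f v)].

Definition isomorphic (K : fieldType) (A B : leibnizType K) : Prop :=
  isomorphic_onto A (fullv : {vspace B}).

Definition as_linear (K : fieldType) (U V : lmodType K) (f : U -> V)
    (lin_f : linear f) : {linear U -> V} :=
  HB.pack f (GRing.isLinear.Build K U V _ f lin_f).

Lemma bracketv_subP (K : fieldType) (L : leibnizType K)
    (U V W : {vspace L}) :
  (forall u v, u \in U -> v \in V -> bracket u v \in W) <->
  (bracketv U V <= W)%VS.
Proof.
split=> [UVW | /subvP sW u v uU vV].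
  apply/span_subvP => _ /allpairsP[[u v] /= [uU vV ->]].
  by apply: UVW; apply: vbasis_mem.
rewrite (coord_vbasis uU) (coord_vbasis vV).
have -> n (s : 'I_n -> L) z :
    bracket (\sum_i s i) z = \sum_i bracket (s i) z.
  exact: (linear_sum (as_linear (bracket_linearl z))).
apply: rpred_sum => i _.
have -> c x z : bracket (c *: x) z = c *: bracket x z.
  exact: (linearZ_LR (as_linear (bracket_linearl z))).
apply: rpredZ.
have -> n (s : 'I_n -> L) z :
    bracket z (\sum_i s i) = \sum_i bracket z (s i).
  exact: (linear_sum (as_linear (bracket_linearr z))).
apply: rpred_sum => j _.
have -> c x z : bracket z (c *: x) = c *: bracket z x.
  exact: (linearZ_LR (as_linear (bracket_linearr z))).
apply: rpredZ.
apply/sW/memv_span/allpairsP.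
by exists ((vbasis U)`_i, (vbasis V)`_j); rewrite /= !mem_nth ?size_tuple.
Qed.

Definition label : Type := (nat + bool)%type.

Local Notation E i := (inl i%N).
Local Notation X := (inr true).
Local Notation Y := (inr false).

(* Multiplication tables on the coordinate space 'rV_m, whose ordered basis is
   e_1, ..., e_n (m = n) or e_1, ..., e_n, x, y (m = n + 2); e_i, x, y are
   labelled E i, X, Y. *)
Section Tables.
Variables (K : fieldType) (n m : nat).
Implicit Types (a b c : label) (u v w : 'rV[K]_m).

Definition basis_label (k : nat) : label :=
  if (k < n)%N then E k.+1 else if k == n then X else Y.

(* Zero when a labels no basis vector. *)
Definition bvec a : 'rV[K]_m := \row_(k < m) (basis_label k == a)%:R.

Local Notation e i := (bvec (E i)).

Definition table_bracket (T : label -> label -> 'rV[K]_m) u v : 'rV[K]_m :=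
  \sum_(i < m) \sum_(j < m)
     (u 0 i * v 0 j) *: T (basis_label i) (basis_label j).

Definition F2_table a b : 'rV[K]_m :=
  match a, b with
  | E 1, E 1 => e 3
  | E i, E 1 => if (3 <= i <= n - 1)%N then e i.+1 else 0
  | _, _ => 0
  end.

Definition L1_table a b : 'rV[K]_m :=
  match a, b with
  | E 1, E 1 => e 3
  | E i, E 1 => if (3 <= i <= n - 1)%N then e i.+1 else 0
  | E 1, X => e 1
  | X, E 1 => - e 1
  | E 2, Y => e 2
  | Y, E 2 => - e 2
  | E i, X => if (3 <= i <= n)%N then (i - 1)%:R *: e i else 0
  | _, _ => 0
  end.

Definition L2_table a b : 'rV[K]_m :=
  match a, b with
  | E 1, E 1 => e 3
  | E i, E 1 => if (3 <= i <= n - 1)%N then e i.+1 else 0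
  | E 1, X => e 1
  | X, E 1 => - e 1
  | E 2, Y => e 2
  | E i, X => if (3 <= i <= n)%N then (i - 1)%:R *: e i else 0
  | _, _ => 0
  end.

Section Bracket.
Variable T : label -> label -> 'rV[K]_m.
Local Notation br := (table_bracket T).

Lemma table_linearl v : linear (br^~ v).
Proof.
move=> c u w; rewrite /table_bracket scaler_sumr -big_split; apply: eq_bigr.
move=> i _; rewrite scaler_sumr -big_split; apply: eq_bigr => j _ /=.
by rewrite !mxE mulrDl scalerDl scalerA mulrA.
Qed.

Lemma table_linearr u : linear (br u).
Proof.
move=> c v w; rewrite /table_bracket scaler_sumr -big_split; apply: eq_bigr.
move=> i _; rewrite scaler_sumr -big_split; apply: eq_bigr => j _ /=.
by rewrite !mxE mulrDr scalerDl scalerA mulrCA.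
Qed.

Lemma table0l v : br 0 v = 0.
Proof. exact: (linear0 (as_linear (table_linearl v))). Qed.
Lemma table0r u : br u 0 = 0.
Proof. exact: (linear0 (as_linear (table_linearr u))). Qed.
Lemma tableNl u v : br (- u) v = - br u v.
Proof. exact: (linearN (as_linear (table_linearl v))). Qed.
Lemma tableNr u v : br u (- v) = - br u v.
Proof. exact: (linearN (as_linear (table_linearr u))). Qed.
Lemma tableZl (c : K) u v : br (c *: u) v = c *: br u v.
Proof. exact: (linearZ_LR (as_linear (table_linearl v))). Qed.
Lemma tableZr (c : K) u v : br u (c *: v) = c *: br u v.
Proof. exact: (linearZ_LR (as_linear (table_linearr u))). Qed.

Hypothesis le_m : (m <= n.+2)%N.

Lemma basis_label_inj (i j : 'I_m) :
  basis_label i = basis_label j -> i = j.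
Proof.
move=> eq_ij; apply: ord_inj; move: eq_ij; rewrite /basis_label.
have := leq_trans (ltn_ord i) le_m; have := leq_trans (ltn_ord j) le_m.
move: (nat_of_ord i) (nat_of_ord j) => p q; rewrite !ltnS => qn pn.
have eqS r : (n <= r)%N -> (r <= n.+1)%N -> r != n -> r = n.+1.
  move=> nr rn r_n; apply/eqP; rewrite eqn_leq rn /=.
  by rewrite ltn_neqAle eq_sym r_n nr.
case: ltnP => np; case: ltnP => nq.
- by case.
- by case: (q == n).
- by case: (p == n).
- case: (eqVneq p n) => [->|pN]; case: (eqVneq q n) => [->|qN] // _.
  by rewrite (eqS p) // (eqS q).
Qed.

Lemma bvec_delta (i : 'I_m) : bvec (basis_label i) = delta_mx 0 i.
Proof.
apply/rowP=> j; rewrite !mxE eqxx /=; congr (nat_of_bool _)%:R.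
by apply/idP/idP => /eqP => [/basis_label_inj-> | ->].
Qed.

Lemma table_bvec (i j : 'I_m) :
  br (bvec (basis_label i)) (bvec (basis_label j))
    = T (basis_label i) (basis_label j).
Proof.
rewrite !bvec_delta /table_bracket (bigD1 i) //= (bigD1 j) //=.
rewrite [X in _ + X]big1 => [|k nk]; last first.
  by rewrite big1 // => l _; rewrite !mxE (negPf nk) mul0r scale0r.
rewrite [X in _ + X + _]big1 => [|k nk]; last first.
  by rewrite !mxE (negPf nk) mulr0 scale0r.
by rewrite !mxE !eqxx mul1r scale1r !addr0.
Qed.

Definition is_basis_label a : bool :=
  match a with
  | E i => (0 < i <= n)%N && (i <= m)%N
  | X => (n < m)%N
  | Y => (n.+1 < m)%N
  end.

Lemma is_basis_labelP a : reflect (exists k : 'I_m, basis_label k = a)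
  (is_basis_label a).
Proof.
apply: (iffP idP) => [|[k <-]]; last first.
  rewrite /basis_label; case: ltnP => [kn|nk] /=; first by rewrite kn ltn_ord.
  case: eqVneq => /= [<-|kN]; first exact: ltn_ord.
  by apply: leq_ltn_trans (ltn_ord k); rewrite ltn_neqAle eq_sym kN.
case: a => [[|i]|[]] //= => [/andP[i_n i_m]|n_m|n_m].
- by exists (Ordinal i_m); rewrite /basis_label /= i_n.
- by exists (Ordinal n_m); rewrite /basis_label /= ltnn eqxx.
- exists (Ordinal n_m); rewrite /basis_label /= ltnNge leqnSn /=.
  by rewrite -[n.+1]addn1 -{2}[n]addn0 eqn_add2l.
Qed.

Lemma is_basis_label_lab (k : 'I_m) : is_basis_label (basis_label k).
Proof. by apply/is_basis_labelP; exists k. Qed.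

Lemma bvec0 a : ~~ is_basis_label a -> bvec a = 0.
Proof.
move=> /is_basis_labelP a0; apply/rowP=> k; rewrite !mxE.
by case: eqP => // ka; case: a0; exists k.
Qed.

Lemma table_bvecE a b : br (bvec a) (bvec b)
  = if is_basis_label a && is_basis_label b then T a b else 0.
Proof.
have [/is_basis_labelP[i <-]|/bvec0->] /= := boolP (is_basis_label a).
  have [/is_basis_labelP[j <-]|/bvec0->] /= := boolP (is_basis_label b).
    exact: table_bvec.
  exact: table0r.
exact: table0l.
Qed.

Lemma table_leibniz :
  (forall i j k : 'I_m,
     let a := basis_label i in let b := basis_label j in
     let c := basis_label k in
     br (bvec a) (T b c) = br (T a b) (bvec c) - br (T a c) (bvec b)) ->
  forall u v w, br u (br v w) = br (br u v) w - br (br u w) v.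
Proof.
move=> H u v w.
have {}H (i j k : 'I_m) : let a := bvec (basis_label i) in let b := bvec (basis_label j)
    in let c := bvec (basis_label k) in
    br a (br b c) = br (br a b) c - br (br a c) b.
  by rewrite /= !table_bvec H.
have suml (s : 'I_m -> 'rV[K]_m) z :
    br (\sum_i s i) z = \sum_i br (s i) z.
  exact: (linear_sum (as_linear (table_linearl z))).
have sumr z (s : 'I_m -> 'rV[K]_m) :
    br z (\sum_i s i) = \sum_i br z (s i).
  exact: (linear_sum (as_linear (table_linearr z))).
move: tableZl tableZr suml sumr H => Zl Zr suml sumr; move: br Zl Zr suml sumr.
move=> B Zl Zr suml sumr H.
rewrite (row_sum_delta u) !suml -sumrB; apply: eq_bigr => i _.
rewrite !Zl -scalerBr; congr (_ *: _).
rewrite (row_sum_delta v) !(sumr, suml) -sumrB; apply: eq_bigr => j _.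
rewrite !(Zl, Zr) -scalerBr; congr (_ *: _).
rewrite (row_sum_delta w) !(sumr, suml) -sumrB; apply: eq_bigr => k _.
rewrite !(Zl, Zr) -scalerBr; congr (_ *: _).
by rewrite -!bvec_delta H.
Qed.

End Bracket.
End Tables.

Definition F2 (K : fieldType) (n : nat) : Type := 'rV[K]_n.
Definition L1 (K : fieldType) (n : nat) : Type := 'rV[K]_(n.+2).
Definition L2 (K : fieldType) (n : nat) : Type := 'rV[K]_(n.+2).

Ltac table_tac :=
  rewrite /=; move=> *;
  repeat (rewrite ?(table0l, table0r, tableNl, tableNr, tableZl, tableZr);
    rewrite ?table_bvecE /=; try lia;
    try match goal with
    | |- context [if ?b then _ else _] =>
        let h := fresh "h" in have [h|h] := boolP b; rewrite /=; try lia
    end);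
  rewrite ?(scaler0, subrr, subr0, sub0r, oppr0, addr0, add0r, opprK) //;
  try solve [rewrite bvec0 ?oppr0 //=; lia];
  try solve [apply/rowP=> q; rewrite !mxE ?subSS ?subn0 /=; ring].

Lemma F2_leibniz (K : fieldType) n (u v w : 'rV[K]_n) :
  let br := table_bracket n (F2_table K n n) in
  br u (br v w) = br (br u v) w - br (br u w) v.
Proof.
move=> br; rewrite {}/br; apply: table_leibniz => //= [|i j k].
  by rewrite leqW.
move: (is_basis_label_lab n i) (is_basis_label_lab n j) (is_basis_label_lab n k).
move: (basis_label n i) (basis_label n j) (basis_label n k) => a b c.
case: c => [[|[|[|c]]]|[]]; case: b => [[|[|[|b]]]|[]];
case: a => [[|[|[|a]]]|[]] //; table_tac.
Qed.

Lemma L1_leibniz (K : fieldType) n (u v w : 'rV[K]_(n.+2)) :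
  let br := table_bracket n (L1_table K n n.+2) in
  br u (br v w) = br (br u v) w - br (br u w) v.
Proof.
move=> br; rewrite {}/br; apply: table_leibniz => //= i j k.
move: (is_basis_label_lab n i) (is_basis_label_lab n j).
move: (is_basis_label_lab n k).
move: (basis_label n i) (basis_label n j) (basis_label n k) => a b c.
case: c => [[|[|[|c]]]|[]]; case: b => [[|[|[|b]]]|[]];
case: a => [[|[|[|a]]]|[]] //; table_tac.
Qed.

Lemma L2_leibniz (K : fieldType) n (u v w : 'rV[K]_(n.+2)) :
  let br := table_bracket n (L2_table K n n.+2) in
  br u (br v w) = br (br u v) w - br (br u w) v.
Proof.
move=> br; rewrite {}/br; apply: table_leibniz => //= i j k.
move: (is_basis_label_lab n i) (is_basis_label_lab n j).
move: (is_basis_label_lab n k).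
move: (basis_label n i) (basis_label n j) (basis_label n k) => a b c.
case: c => [[|[|[|c]]]|[]]; case: b => [[|[|[|b]]]|[]];
case: a => [[|[|[|a]]]|[]] //; table_tac.
Qed.

HB.instance Definition _ (K : fieldType) n := Vector.on (F2 K n).
HB.instance Definition _ (K : fieldType) n :=
  Vector_isLeibniz.Build K (F2 K n)
    (table_linearl n (F2_table K n n)) (table_linearr n (F2_table K n n))
    (@F2_leibniz K n).

HB.instance Definition _ (K : fieldType) n := Vector.on (L1 K n).
HB.instance Definition _ (K : fieldType) n :=
  Vector_isLeibniz.Build K (L1 K n)
    (table_linearl n (L1_table K n n.+2)) (table_linearr n (L1_table K n n.+2))
    (@L1_leibniz K n).

HB.instance Definition _ (K : fieldType) n := Vector.on (L2 K n).
HB.instance Definition _ (K : fieldType) n :=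
  Vector_isLeibniz.Build K (L2 K n)
    (table_linearl n (L2_table K n n.+2)) (table_linearr n (L2_table K n n.+2))
    (@L2_leibniz K n).

(* Main.v *)
(* Right multiplications by elements z of L are derivations of the nilradical N,
   hence triangular in the basis e_1, ..., e_n with diagonal (a, b, 2a, 3a, ...,
   (n-1)a), where a and b are linear in z and vanish on [L, L].  Where a = b = 0,
   z acts nilpotently on N, so maximality of N and solvability give
   N = {a = b = 0}; as N has codimension 2 there are x with (a, b) = (1, 0) and
   y with (a, b) = (0, 1).  Right multiplication by x has the n distinct
   eigenvalues 1, 0, 2, ..., n-1 on N: its eigenvectors form a new basis with the
   same products, and the remaining products are determined by their weights up
   to a correction of x and y by elements of N.  The only parameter left is
   [y, e_2] = q e_2, with q^2 = -q. *)
From HB Require Import structures.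
Require Import Defs.
From mathcomp Require Import all_boot all_order all_algebra.
From mathcomp Require Import reals complex.
From mathcomp Require Import zify.

Set Implicit Arguments.
Unset Strict Implicit.
Unset Printing Implicit Defensive.

Import GRing.Theory.
Local Open Scope ring_scope.
Local Open Scope complex_scope.

(** * Bilinearity and first consequences of the Leibniz identity *)

Section BracketTheory.
Variables (K : fieldType) (L : leibnizType K).
Implicit Types (u v w z : L) (c : K).

HB.instance Definition _ u :=
  GRing.isLinear.Build K L L _ (bracket u) (bracket_linearr u).

Lemma bracketDr u v w : bracket u (v + w) = bracket u v + bracket u w.
Proof. exact: linearD. Qed.
Lemma bracketBr u v w : bracket u (v - w) = bracket u v - bracket u w.
Proof. exact: linearB. Qed.
Lemma bracketZr c u v : bracket u (c *: v) = c *: bracket u v.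
Proof. exact: linearZ. Qed.
Lemma bracket0r u : bracket u 0 = 0.
Proof. exact: linear0. Qed.
Lemma bracket_sumr I r (P : pred I) (F : I -> L) u :
  bracket u (\sum_(i <- r | P i) F i) = \sum_(i <- r | P i) bracket u (F i).
Proof. exact: linear_sum. Qed.

Definition right_mul z : {linear L -> L} := as_linear (bracket_linearl z).

Lemma bracketDl u v w : bracket (u + v) w = bracket u w + bracket v w.
Proof. exact: (linearD (right_mul w)). Qed.
Lemma bracketBl u v w : bracket (u - v) w = bracket u w - bracket v w.
Proof. exact: (linearB (right_mul w)). Qed.
Lemma bracketZl c u v : bracket (c *: u) v = c *: bracket u v.
Proof. exact: (linearZ_LR (right_mul v)). Qed.
Lemma bracket0l v : bracket 0 v = 0.
Proof. exact: (linear0 (right_mul v)). Qed.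
Lemma bracket_suml I r (P : pred I) (F : I -> L) w :
  bracket (\sum_(i <- r | P i) F i) w = \sum_(i <- r | P i) bracket (F i) w.
Proof. exact: (linear_sum (right_mul w)). Qed.

Lemma right_mul_derivation u v z :
  bracket (bracket u v) z = bracket (bracket u z) v + bracket u (bracket v z).
Proof. by rewrite leibniz_identity addrC subrK. Qed.

(** The right side of the Leibniz identity is antisymmetric in its last two arguments, so left
    multiplications kill squares and, below, symmetrised products. *)
Lemma bracket_square z u : bracket z (bracket u u) = 0.
Proof. by rewrite leibniz_identity subrr. Qed.

Lemma bracket_symm z u v : bracket z (bracket u v + bracket v u) = 0.
Proof. by rewrite bracketDr !leibniz_identity addrC subrKA subrr. Qed.

Lemma bracket_annr u v : (forall z, bracket z u = 0) ->
  forall z, bracket z (bracket u v) = 0.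
Proof. by move=> u0 z; rewrite leibniz_identity !u0 bracket0l subrr. Qed.

Lemma mem_bracketv (U V : {vspace L}) u v :
  u \in U -> v \in V -> bracket u v \in bracketv U V.
Proof. exact: (bracketv_subP U V (bracketv U V)).2. Qed.

End BracketTheory.

(** * An adapted basis of the nilradical and its coordinate forms *)

Definition as_scalar (K : fieldType) (U : lmodType K) (f : U -> K)
    (lin_f : scalar f) : {scalar U} :=
  HB.pack f (GRing.isLinear.Build K U K *%R f lin_f).

(** Indices start from 0: [e k] stands for e_(k+1). The value [n] at 1 encodes [e_2, e_1] = 0,
    because [e] is extended by zero from index [n] on. *)
Definition next_index n i : nat :=
  match i with 0 => 2 | 1 => n | _ => i.+1 end.

Lemma F2_frame (K : fieldType) n (L : leibnizType K) (N : {vspace L}) :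
  (2 < n)%N -> isomorphic_onto (F2 K n) N ->
  exists (e : nat -> L) (cd : nat -> {scalar L}),
  [/\ (forall k, e k \in N) /\ (forall k, (n <= k)%N -> e k = 0),
      forall j k, (j < n)%N -> cd j (e k) = (j == k)%:R,
      forall u, u \in N -> u = \sum_(k < n) cd k u *: e k,
      forall i, bracket (e i) (e 0%N) = e (next_index n i)
    & forall u k, u \in N -> bracket u (e k.+1) = 0].
Proof.
move=> n_gt2 [f [f_inj f_im fM]].
pose e k := f (bvec K n n (inl k.+1)).
have finv u : u \in N -> f (f^-1 u)%VF = u by rewrite -f_im => /limg_lfunVK.
(* The sum has at most one term; it makes the coordinate total in [k], with value 0 for [k >= n]. *)
pose c k u : K := \sum_(j < n | val j == k) (f^-1 u)%VF 0 j.
have c_lin k : scalar (c k).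
  move=> a u v; rewrite /c big_distrr -big_split; apply: eq_bigr => j _ /=.
  by rewrite linearP !mxE.
exists e, (fun k => as_scalar (c_lin k)).
have bE (i : 'I_n) : bvec K n n (inl i.+1) = delta_mx 0 i.
  by rewrite -(@bvec_delta _ n) ?leqW // /basis_label ltn_ord.
have eE a b : bracket (f (bvec K n n a)) (f (bvec K n n b))
   = if is_basis_label n n a && is_basis_label n n b
     then f (F2_table K n n a b) else 0.
  rewrite -fM [bracket _ _]table_bvecE ?leqW //.
  by case: ifP => //; rewrite linear0.
have eN k : e k \in N by rewrite -f_im memv_img ?memvf.
have e0 k : (n <= k)%N -> e k = 0.
  by move=> nk; rewrite /e bvec0 ?linear0 //= ltnNge nk.
have eS u : u \in N -> u = \sum_(k < n) c k u *: e k.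
  move=> uN; rewrite -{1}[u]finv // {1}[(f^-1 _)%VF]row_sum_delta linear_sum.
  apply: eq_bigr => k _; rewrite linearZ /= /e bE; congr (_ *: _).
  by rewrite /c (big_pred1 k) // => j; rewrite eqE.
split=> //=.
- move=> j k jn; rewrite /c (big_pred1 (Ordinal jn)) => [|i];
    last by rewrite eqE.
  rewrite /e lker0_lfunK ?f_inj // mxE /basis_label jn /=.
  by congr (nat_of_bool _)%:R; apply/eqP/eqP => [[]|->].
- move=> i; rewrite [LHS]eE /= /e.
  have [i_n|ni] := ltnP i n; rewrite /=; last first.
    by case: i ni => [|[|i]] ni; try lia; rewrite bvec0 ?linear0 //=; lia.
  have -> : (0 < n)%N by lia.
  case: i i_n => [|[|i]] //= i_n; first by rewrite bvec0 ?linear0 //= ltnn.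
  case: ifP => // /negbT h; rewrite bvec0 ?linear0 //=; lia.
- move=> u k /eS->; rewrite bracket_suml big1 // => i _.
  rewrite bracketZl eE /=; case: ifP; rewrite ?scaler0 //.
  by case: (i : nat) => [|[|[|m]]]; rewrite ?linear0 ?scaler0.
Qed.

(** The eigenvalues of right multiplication by x on N: the identity with 0 and 1 exchanged, hence
    injective. *)
Definition x_weight k : nat := match k with 0 => 1 | 1 => 0 | _ => k end.

Lemma x_weight_inj (K : fieldType) k j :
  (forall m, m.+1%:R != 0 :> K) -> (k < j)%N ->
  (x_weight j)%:R != (x_weight k)%:R :> K.
Proof.
move=> char0; have natr_inj p q : p != q -> p%:R != q%:R :> K.
  wlog lt_pq : p q / (p < q)%N => [IH|_].
    by rewrite neq_ltn => /orP[] h; [|rewrite eq_sym]; apply: IH => //; lia.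
  rewrite eq_sym -subr_eq0 -natrB; last exact: ltnW.
  by rewrite -(ltn_predK (_ : 0 < q - p)%N) // subn_gt0.
by move=> kj; apply: natr_inj; case: k j kj => [|[|k]] [|[|j]] //=; lia.
Qed.

(** * Triangularity of right multiplications on N *)

Section Triangular.
Variables (K : fieldType) (n : nat) (L : leibnizType K) (N : {vspace L}).
Variables (e : nat -> L) (cd : nat -> {scalar L}).
Hypothesis n_gt2 : (2 < n)%N.
Hypothesis N_ideal : is_ideal N.
Hypothesis eN : forall k, e k \in N.
Hypothesis e_out : forall k, (n <= k)%N -> e k = 0.
Hypothesis cd_e : forall j k, (j < n)%N -> cd j (e k) = (j == k)%:R.
Hypothesis e_dec : forall u, u \in N -> u = \sum_(k < n) cd k u *: e k.
Hypothesis e_e0 : forall i, bracket (e i) (e 0%N) = e (next_index n i).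
Hypothesis N_eS : forall u k, u \in N -> bracket u (e k.+1) = 0.

Implicit Types (u v z : L) (i j k : nat).

Let Nl u z : u \in N -> bracket u z \in N.
Proof. by case/(N_ideal z). Qed.
Let Nr u z : u \in N -> bracket z u \in N.
Proof. by case/(N_ideal z). Qed.

Lemma coord_inj u v : u \in N -> v \in N ->
  (forall k, (k < n)%N -> cd k u = cd k v) -> u = v.
Proof.
move=> uN vN uv; rewrite (e_dec uN) (e_dec vN).
by apply: eq_bigr => k _; rewrite uv.
Qed.

Lemma bracket_N u v : u \in N -> v \in N ->
  bracket u v = cd 0%N v *: bracket u (e 0%N).
Proof.
move=> uN vN; rewrite {1}(e_dec vN) bracket_sumr.
have n_gt0 : (0 < n)%N by lia.
rewrite (bigD1 (Ordinal n_gt0)) //= bracketZr big1 ?addr0 // => i i_n0.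
rewrite bracketZr; case: i i_n0 => [[|i] /= lt_in] // _.
by rewrite N_eS ?scaler0.
Qed.

Lemma coord_bracket_e0 u k : u \in N -> (k < n)%N ->
  cd k (bracket u (e 0%N)) =
  match k with 0 | 1 => 0 | 2 => cd 0%N u | k'.+1 => cd k' u end.
Proof.
move=> uN kn; rewrite {1}(e_dec uN) bracket_suml linear_sum.
have lin (i : 'I_n) : cd k (bracket (cd i u *: e i) (e 0%N)) =
    cd i u * (k == next_index n i)%:R.
  by rewrite bracketZl linearZ /= e_e0 cd_e.
rewrite (eq_bigr _ (fun (i : 'I_n) _ => lin i)) {lin}.
have zero : (forall i : 'I_n, k != next_index n i) ->
    \sum_(i < n) cd i u * (k == next_index n i)%:R = 0.
  by move=> kN; rewrite big1 // => i _; rewrite (negPf (kN i)) mulr0.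
(* Below [n] the map [next_index] is injective, since its value at 1 is out of range; so one term
   survives. *)
have one (i : 'I_n) : k = next_index n i ->
    \sum_(i < n) cd i u * (k == next_index n i)%:R = cd i u.
  move=> ki; rewrite (bigD1 i) //= -ki eqxx mulr1 big1 ?addr0 // => j ji.
  rewrite (_ : (k == _) = false) ?mulr0 //; apply/eqP=> kj; case/eqP: ji.
  apply: val_inj => /=; move: ki kj; rewrite /next_index.
  by case: (i : nat) => [|[|?]]; case: (j : nat) => [|[|?]]; lia.
have [k0|] := boolP (k < 2)%N.
  rewrite zero => [|i]; first by case: k k0 {kn one zero} => [|[|]].
  move=> *; rewrite /next_index. case: (i : nat) => [|[|?]]. lia. lia. lia.
case: k kn zero one => [|[|[|k]]] //= kn _ one _.
  by exact: (one (Ordinal (leq_trans (ltn0Sn 2) kn))).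
by exact: (one (Ordinal (ltnW kn))).
Qed.

(** The flag of N that all right multiplications preserve; it begins with N and is zero from [n]
    on. *)
Definition tailv k : {vspace L} := (\sum_(i < n | (k <= i)%N) <[e i]>)%VS.

Lemma tailvP k u :
  reflect (u \in N /\ forall i, (i < k)%N -> (i < n)%N -> cd i u = 0)
          (u \in tailv k).
Proof.
apply: (iffP memv_sumP) => [[s s_e ->]|[uN u0]].
  split=> [|i ik lt_in].
    by apply: rpred_sum => i ki; have /vlineP[c ->] := s_e i ki; apply: rpredZ.
  rewrite linear_sum big1 // => j kj; have /vlineP[c ->] := s_e j kj.
  by rewrite linearZ /= cd_e // (_ : (i == j) = false) ?mulr0 //; lia.
exists (fun i : 'I_n => cd i u *: e i) => [i _|].
  by rewrite rpredZ ?memv_line.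
rewrite [LHS]e_dec //; rewrite [RHS]big_mkcond; apply: eq_bigr => i _.
by case: leqP => // /u0->; rewrite ?scale0r.
Qed.

Lemma tailv0 u : (u \in tailv 0) = (u \in N).
Proof. by apply/tailvP/idP => [[]|]. Qed.

Lemma tailv_out k u : (n <= k)%N -> u \in tailv k -> u = 0.
Proof.
move=> nk /tailvP[uN u0]; apply: coord_inj; rewrite ?mem0v // => i lt_in.
by rewrite linear0 u0 //; lia.
Qed.

Lemma tailvW k j u : (j <= k)%N -> u \in tailv k -> u \in tailv j.
Proof.
move=> jk /tailvP[uN u0]; apply/tailvP; split=> // i ij lt_in.
by apply: u0; lia.
Qed.

Lemma tailvN k u : u \in tailv k -> u \in N.
Proof. by case/tailvP. Qed.

Lemma tailvS k u : u \in tailv k -> cd k u = 0 -> u \in tailv k.+1.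
Proof.
move=> /tailvP[uN u0] uk; apply/tailvP; split=> // i ik lt_in.
by have [->|] := eqVneq i k; [|move=> ?; apply: u0; lia].
Qed.

Lemma bracket_NN u v : u \in N -> v \in N -> bracket u v \in tailv 2.
Proof.
move=> uN vN; apply/tailvP; split=> [|i i2 lt_in]; first exact: Nl.
rewrite bracket_N // linearZ /= coord_bracket_e0 //.
by case: i i2 {lt_in} => [|[|]] // _; rewrite mulr0.
Qed.

(* The eigenvalues of right multiplication by z on N. *)
Definition weight z k : K :=
  match k with
  | 0 => cd 0%N (bracket (e 0%N) z)
  | 1 => cd 1%N (bracket (e 1%N) z)
  | _ => k%:R * cd 0%N (bracket (e 0%N) z)
  end.

Lemma weight_is_linear k : scalar (weight^~ k).
Proof.
move=> c y z; rewrite /weight.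
by case: k => [|[|k]]; rewrite bracketDr bracketZr linearP // mulrDr mulrCA.
Qed.

(** Right multiplication by z is a derivation, so triangularity passes along e_3 = [e_1, e_1] and
    e_(i+1) = [e_i, e_1], each step adding the weight of e_1. Only e_2 needs a separate argument. *)
Lemma e_triangular z k : (k < n)%N ->
  bracket (e k) z \in tailv k /\ cd k (bracket (e k) z) = weight z k.
Proof.
elim: k => [|[|[|k]] IHk] kn.
- by rewrite tailv0 Nl.
- split=> //; apply: tailvS; first by rewrite tailv0 Nl.
  (* The e_3-coordinate of [[e_2, z], e_1] is the e_1-coordinate of [e_2, z]. Deriving [e_2, e_1] =
     0 shows that it vanishes, as [e_2, [e_1, z]] is a multiple of [e_2, e_1]. *)
  have := congr1 (cd 2) (right_mul_derivation (e 1%N) (e 0%N) z).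
  rewrite e_e0 /= (e_out (leqnn n)) bracket0l linear0 linearD /=
    coord_bracket_e0 ?Nl //.
  rewrite [bracket _ (bracket _ _)]bracket_N ?Nl // e_e0 /= (e_out (leqnn n)).
  by rewrite scaler0 linear0 addr0.
- have -> : e 2 = bracket (e 0%N) (e 0%N) by rewrite e_e0.
  rewrite right_mul_derivation; split; first by rewrite rpredD // bracket_NN ?Nl.
  rewrite linearD /= coord_bracket_e0 ?Nl //.
  rewrite [bracket _ (bracket _ _)]bracket_N ?Nl // linearZ /=.
  by rewrite e_e0 cd_e //= mulr1 mulr_natl.
have [lt_k2n lt_0n] : (k.+2 < n)%N /\ (0 < n)%N by lia.
have [/tailvP[_ ek_0] ek_k] := IHk lt_k2n.
have -> : e k.+3 = bracket (e k.+2) (e 0%N) by rewrite e_e0.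
rewrite right_mul_derivation [bracket (e k.+2) (bracket _ _)]bracket_N ?Nl //.
split.
  apply/tailvP; split=> [|i lt_ik lt_in]; first by rewrite rpredD ?rpredZ ?Nl.
  rewrite linearD linearZ /= e_e0 cd_e // [i == _](_ : _ = false); last first.
    by rewrite /=; lia.
  rewrite mulr0 addr0 coord_bracket_e0 ?Nl //.
  by case: i lt_ik lt_in => [|[|[|i]]] // ? ?; apply: ek_0; lia.
rewrite linearD linearZ /= coord_bracket_e0 ?Nl // e_e0 cd_e //= eqxx mulr1.
by rewrite ek_k -[in RHS]addn1 natrD mulrDl mul1r.
Qed.

Lemma triangular z k u : (k < n)%N -> u \in tailv k ->
  bracket u z \in tailv k /\ cd k (bracket u z) = cd k u * weight z k.
Proof.
move=> kn /tailvP[uN u0].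
have E : bracket u z = \sum_(i < n) cd i u *: bracket (e i) z.
  rewrite {1}(e_dec uN) bracket_suml; apply: eq_bigr => i _.
  by rewrite bracketZl.
split.
  rewrite E; apply: rpred_sum => i _; have [ik|ki] := ltnP i k.
    by rewrite u0 // scale0r mem0v.
  by apply/rpredZ/(tailvW ki); case: (e_triangular z (ltn_ord i)).
rewrite E linear_sum (bigD1 (Ordinal kn)) //= linearZ /=.
rewrite (e_triangular z kn).2 big1 ?addr0 // => i i_k; rewrite linearZ /=.
have [ik|ki] := ltnP i k; first by rewrite u0 // mul0r.
have /tailvP[_ ->] := (e_triangular z (ltn_ord i)).1; rewrite ?mulr0 //.
rewrite ltn_neqAle ki eq_sym andbT.
by apply: contraNneq i_k => ik; apply/eqP/val_inj.
Qed.

(** Right multiplication by [y, z] is, up to sign, the commutator of two triangular operators, so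
    its diagonal is zero. *)
Lemma weight_bracket y z k : (k < n)%N -> weight (bracket y z) k = 0.
Proof.
move=> kn; have [ky ey] := e_triangular y kn; have [kz ez] := e_triangular z kn.
have [_ <-] := e_triangular (bracket y z) kn.
rewrite leibniz_identity linearB /= (triangular z kn ky).2.
by rewrite (triangular y kn kz).2 ey ez mulrC subrr.
Qed.

Lemma weight_N u k : u \in N -> (k < n)%N -> weight u k = 0.
Proof.
move=> uN kn; have [_ <-] := e_triangular u kn.
rewrite bracket_N // linearZ /= e_e0 cd_e // (_ : _ == _ = false) ?mulr0 //.
by case: k kn => [|[|k]] kn /=; lia.
Qed.

(** A zero diagonal pushes each step of the flag into the next one; once the lower central series of
    M has entered N, it vanishes after at most n more brackets. *)
Lemma nilpotent_of_weight0 (M : {vspace L}) : (bracketv M M <= N)%VS ->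
  (forall z k, z \in M -> (k < n)%N -> weight z k = 0) -> is_nilpotent M.
Proof.
move=> MN M0.
have lcM k : (k <= n)%N -> (lower_central M k.+1 <= tailv k)%VS.
  elim: k => [_|k IHk kn].
    by apply/subvP=> u /(subvP MN); rewrite tailv0.
  have lt_kn : (k < n)%N by [].
  apply/bracketv_subP=> u z /(subvP (IHk (ltnW kn))) u_k zM.
  by have [? E] := triangular z lt_kn u_k; rewrite tailvS // E M0 ?mulr0.
exists n.+1; apply/eqP; rewrite -subv0; apply/subvP=> u /(subvP (lcM n _)) u_n.
by rewrite (tailv_out _ (u_n _)) ?mem0v.
Qed.

(** The two free weights (a, b), all the others being multiples of a. Taking [K^o] as target makes
    the rank-nullity formula available. *)
Definition diag_weights : 'Hom(L, (K^o * K^o)%type) :=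
  linfun (fun z => (weight z 0 : K^o, weight z 1 : K^o)).

Lemma diag_weightsE z : diag_weights z = (weight z 0, weight z 1).
Proof.
have lin : linear (fun z => (weight z 0 : K^o, weight z 1 : K^o)).
  by move=> c u v; rewrite !weight_is_linear.
exact: (lfunE (as_linear lin)).
Qed.

Lemma ker_weightsP z :
  reflect (forall k, (k < n)%N -> weight z k = 0) (z \in lker diag_weights).
Proof.
rewrite memv_ker diag_weightsE; apply: (iffP eqP) => [[w0 w1] [|[|k]] // _|w0].
  by rewrite /weight w0 mulr0.
by rewrite !w0 //; lia.
Qed.

Lemma N_sub_ker : (N <= lker diag_weights)%VS.
Proof. by apply/subvP=> u uN; apply/ker_weightsP => k; apply: weight_N. Qed.

(** * The nilradical as the common kernel of the weights *)

Section WeightBasis.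
Hypothesis dimN : \dim N = n.
Hypothesis dimL : \dim (fullv : {vspace L}) = n.+2.
Hypothesis L_solvable : is_solvable (fullv : {vspace L}).
Hypothesis N_nilradical : is_nilradical N.

Let L' : {vspace L} := bracketv fullv fullv.

Let memL' u z : bracket u z \in L'.
Proof. by rewrite mem_bracketv ?memvf. Qed.

(* [z, [z, z]] = 0 forces [z, z] into N, so that N + <z> would be a nilpotent
   ideal. *)
Lemma no_weight0_extension z : z \in lker diag_weights ->
  (L' <= N + <[z]>)%VS -> z \in N.
Proof.
move=> /ker_weightsP z0 L'M; set M := (N + <[z]>)%VS in L'M.
have NM : (N <= M)%VS by apply: addvSl.
have M_dec u : u \in M -> exists2 m, m \in N & exists c, u = m + c *: z.
  by case/memv_addP=> m mN [_ /vlineP[c ->] ->]; exists m => //; exists c.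
have zzN : bracket z z \in N.
  have [m mN [c zz]] := M_dec _ (subvP L'M _ (memL' z z)).
  have [c0|c0] := eqVneq c 0; first by rewrite zz c0 scale0r addr0.
  have := bracket_square z z; rewrite {1}zz bracketDr bracketZr => /eqP.
  rewrite addr_eq0 -scaleNr => /eqP E; have := Nr z mN.
  by rewrite E rpredZeq oppr_eq0 (negPf c0).
case: N_nilradical => _ _ /(_ M) <- //.
- exact: (subvP (addvSr N _) _ (memv_line z)).
- by move=> u v uM; split; apply: (subvP L'M).
apply: nilpotent_of_weight0 => [|u k /M_dec[m mN [c ->]] kn]; last first.
  by rewrite addrC weight_is_linear z0 // weight_N // mulr0 addr0.
apply/bracketv_subP=> _ _ /M_dec[m mN [c ->]] /M_dec[m' m'N [c' ->]].
rewrite bracketDl !bracketDr !(bracketZl, bracketZr) !rpredD //;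
  do ?apply: rpredZ => //; by [apply: Nl | apply: Nr].
Qed.

(** If N + L' were L, expanding brackets modulo the ideal N would give N + D = L for every term D of
    the derived series; solvability would then force N = L, against the dimensions. *)
Lemma N_add_derived : (N + L' != fullv)%VS.
Proof.
apply/eqP=> NL'; have [s Ls] := L_solvable.
have NLs t : (N + derived_series fullv t)%VS = fullv.
  elim: t => [|t IHt /=]; first by rewrite addvf.
  apply/eqP; rewrite eqEsubv subvf -[X in (X <= _)%VS]NL' subv_add addvSl.
  apply/bracketv_subP=> u v _ _.
  have dec z : z \in (N + derived_series fullv t)%VS by rewrite IHt memvf.
  have /memv_addP[m mN [d dD ->]] := dec u.
  have /memv_addP[m' m'N [d' d'D ->]] := dec v.
  rewrite bracketDl !bracketDr addrA; apply: memv_add; last exact: mem_bracketv.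
  by rewrite !rpredD //; [apply: Nl | apply: Nl | apply: Nr].
by have := NLs s; rewrite Ls addv0 => /(congr1 (fun V => \dim V)); lia.
Qed.

(** If L' lies in N, every z of zero weights is absorbed by [no_weight0_extension]. Otherwise some t
    in L' lies outside N; since N has codimension 2 and N + L' is proper, N + <t> = N + L', and t,
    having zero weights as an element of L', is absorbed into N as well, a contradiction. *)
Lemma ker_weights : lker diag_weights = N.
Proof.
apply/eqP; rewrite eqEsubv N_sub_ker andbT; apply/subvP => z z0.
have [L'N|/subvPn[t tL' tN]] := boolP (L' <= N)%VS.
  by apply: no_weight0_extension => //; apply: subv_trans L'N (addvSl _ _).
have NtN : (N + <[t]> == N + L')%VS.
  rewrite eqEdim addvS //=.
  have lt_N : (\dim N < \dim (N + <[t]>)%VS)%N.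
    rewrite ltnNge; apply: contra tN => le_N.
    have /eqP-> : N == (N + <[t]>)%VS by rewrite eqEdim addvSl.
    exact: (subvP (addvSr N _) _ (memv_line t)).
  have lt_L : (\dim (N + L')%VS < n.+2)%N.
    rewrite -dimL ltnNge; apply: contra N_add_derived => le_L.
    by rewrite eqEdim subvf.
  lia.
have t0 : t \in lker diag_weights.
  suff /subvP : (L' <= lker diag_weights)%VS by apply.
  apply/bracketv_subP=> u v _ _; apply/ker_weightsP => k.
  exact: weight_bracket.
case/negP: tN; apply: no_weight0_extension => //.
by rewrite (eqP NtN) addvSr.
Qed.

Lemma weight_basis : exists x y, [/\
  forall k, (k < n)%N -> weight x k = (x_weight k)%:R,
  weight y 0 = 0 /\ weight y 1 = 1,
  forall u z, bracket u z \in N &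
  forall z, exists a b, z - a *: x - b *: y \in N].
Proof.
(* Rank-nullity: the kernel N has codimension 2, the dimension of the target. *)
have im : limg diag_weights = fullv.
  apply/eqP; rewrite eqEdim subvf /= dimvf.
  have := limg_ker_dim diag_weights fullv.
  rewrite capfv ker_weights dimN dimL -addn2 => /addnI->.
  by [].
have preim p : exists z, diag_weights z = p.
  have : p \in limg diag_weights by rewrite im memvf.
  by case/memv_imgP=> z _ ->; exists z.
have [x] := preim (1, 0); rewrite diag_weightsE => -[x0 x1].
have [y] := preim (0, 1); rewrite diag_weightsE => -[y0 y1].
exists x, y; split=> //.
- move=> [|[|k]] // kn; by rewrite /weight x0 mulr1.
- move=> u z; rewrite -ker_weights; apply/ker_weightsP => k.
  exact: weight_bracket.
have [wx0 wx1] : weight x 0 = 1 /\ weight x 1 = 0 by [].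
have [wy0 wy1] : weight y 0 = 0 /\ weight y 1 = 1 by [].
move=> z; exists (weight z 0), (weight z 1).
rewrite -ker_weights memv_ker !linearB !linearZ /= !diag_weightsE.
rewrite wx0 wx1 wy0 wy1; apply/eqP; congr (_, _) => /=.
  by rewrite oppr0 scaler0 addr0 scalerN [_ *: 1]mulr1 subrr.
by rewrite oppr0 scaler0 addr0 scalerN [_ *: 1]mulr1 subrr.
Qed.

End WeightBasis.

(** * Eigenvectors of the triangular operators *)

Lemma eigenvalue_tail_surj z (a : K) k u :
  (forall j, (k <= j < n)%N -> weight z j != a) -> u \in tailv k ->
  exists2 t, t \in tailv k & bracket t z - a *: t = u.
Proof.
have [m] := ubnP (n - k); elim: m k u => // m IHm k u lt_m z_a u_k.
have [nk|kn] := leqP n k.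
  exists 0; first exact: mem0v.
  by rewrite bracket0l scaler0 subr0 (tailv_out nk u_k).
have wa : weight z k - a != 0 by rewrite subr_eq0 z_a ?leqnn.
have [e_k cd_ek] := e_triangular z kn.
(* The diagonal entry [weight z k - a] is invertible, so this multiple of [e k] removes coordinate
   [k]; the remainder is solved further down the flag. *)
pose c := cd k u / (weight z k - a).
have ek : e k \in tailv k.
  by apply/tailvP; split=> // i ik lt_in; rewrite cd_e // ltn_eqF.
have r_k : u - c *: (bracket (e k) z - a *: e k) \in tailv k.+1.
  apply: tailvS; first by rewrite !(rpredB, rpredZ).
  rewrite linearB linearZ /= linearB linearZ /= cd_ek cd_e // eqxx mulr1.
  by rewrite divfK // subrr.
have [||t t_k tE] := IHm k.+1 _ _ _ r_k; first by lia.
  by move=> j /andP[kj jn]; apply: z_a; rewrite jn ltnW.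
exists (t + c *: e k); first by rewrite rpredD ?rpredZ // (tailvW _ t_k).
rewrite bracketDl bracketZl scalerDr opprD addrACA tE scalerBr !scalerA mulrC.
by rewrite subrK.
Qed.

Lemma eigenvector_tail0 z (a : K) k u :
  (forall j, (k <= j < n)%N -> weight z j != a) -> u \in tailv k ->
  bracket u z = a *: u -> u = 0.
Proof.
move=> z_a u_k uz; suff u_n : u \in tailv (maxn k n).
  by apply: tailv_out u_n; rewrite leq_maxr.
have u_m m : (k <= m <= maxn k n)%N -> u \in tailv m.
  elim: m => [|m IHm] km; first by apply: tailvW u_k; lia.
  have [<-|k_m] := eqVneq k m.+1; first by [].
  have {}IHm : u \in tailv m by apply: IHm; lia.
  have lt_mn : (m < n)%N by lia.
  apply: tailvS => //; have [_] := triangular z lt_mn IHm.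
  rewrite uz linearZ /= mulrC => /eqP; rewrite -subr_eq0 -mulrBr mulf_eq0.
  rewrite subr_eq0 [a == _]eq_sym (negPf (z_a m _)) ?orbF => [/eqP //|].
  by lia.
by apply: u_m; rewrite leq_maxl leqnn.
Qed.

(** The error [e_k, z] - w_k e_k lies in the next step of the flag, where the operator minus w_k is
    onto because only the later weights occur there; hence e_k can be corrected to an
    eigenvector. *)
Lemma eigenvector_tail z k : (k < n)%N ->
  (forall j, (k < j < n)%N -> weight z j != weight z k) ->
  exists v, [/\ v \in tailv k, cd k v = 1 & bracket v z = weight z k *: v].
Proof.
move=> kn zj; have [e_k cd_ek] := e_triangular z kn.
have ek : e k \in tailv k.
  by apply/tailvP; split=> // i ik lt_in; rewrite cd_e // ltn_eqF.
have r_k : bracket (e k) z - weight z k *: e k \in tailv k.+1.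
  apply: tailvS; first by rewrite !(rpredB, rpredZ).
  by rewrite linearB linearZ /= cd_ek cd_e // eqxx mulr1 subrr.
have [t t_k tE] := eigenvalue_tail_surj zj r_k.
exists (e k - t); split; first by rewrite rpredB // (tailvW _ t_k).
  by rewrite linearB /= cd_e // eqxx; have /tailvP[_ ->] := t_k; rewrite ?subr0.
move/eqP: tE; rewrite subr_eq bracketBl scalerBr => /eqP->.
by rewrite opprD addrA subKr.
Qed.

Definition eigenframe (v w : L) k : L :=
  match k with
  | 0 => v | 1 => w | k'.+2 => iter k' (right_mul v) (bracket v v)
  end.

(** Only the eigenvectors v and w for the first two weights are chosen; the rest are generated from
    v by products. They are eigenvectors because weights add under a derivation. *)
Lemma eigenframe_ex x : (forall m, m.+1%:R != 0 :> K) ->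
  (forall k, (k < n)%N -> weight x k = (x_weight k)%:R) ->
  exists e' : nat -> L,
  [/\ (forall k, e' k \in tailv k) /\ (forall k, (k < n)%N -> cd k (e' k) = 1),
      forall i, bracket (e' i) (e' 0%N) = e' (next_index n i),
      forall u k, u \in N -> bracket u (e' k.+1) = 0
    & forall k, bracket (e' k) x = (x_weight k)%:R *: e' k].
Proof.
move=> char0 xk; have n_gt0 : (0 < n)%N by lia. have n_gt1 : (1 < n)%N by lia.
have [j /andP[j0 jn]|v [v_0 v1 vx]] := eigenvector_tail (z := x) n_gt0.
  by rewrite !xk // x_weight_inj.
have [j /andP[j0 jn]|w [w_1 w1 wx]] := eigenvector_tail (z := x) n_gt1.
  by rewrite !xk // x_weight_inj.
rewrite !xk // in vx wx; exists (eigenframe v w).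
have vN := tailvN v_0; have wN := tailvN w_1.
have cdw : cd 0 w = 0 by have /tailvP[_ ->] := w_1.
(* The e_1-coordinate of v is 1, and right multiplication of N by an element of N depends on that
   coordinate alone. *)
have uv u : u \in N -> bracket u v = bracket u (e 0).
  by move=> uN; rewrite bracket_N // v1 scale1r.
have tail k : eigenframe v w k \in tailv k.
  case: k => [|[|k]] //=; elim: k => [|k IHk] /=; first exact: bracket_NN.
  have kN := tailvN IHk; apply/tailvP; split=> [|i ik lt_in]; first exact: Nl.
  rewrite uv // coord_bracket_e0 //; move/tailvP: IHk => [_ IHk].
  by case: i ik lt_in => [|[|[|i]]] // ik lt_in; apply: IHk; lia.
split.
- split=> // -[|[|k]] //=; elim: k => [|k IHk] kn /=.
    by rewrite uv // coord_bracket_e0.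
  by rewrite uv ?coord_bracket_e0 ?IHk ?(tailvN (tail k.+2)) // ltnW.
- case=> [|[|i]] //=.
  (* The required value is 0. Indeed [w, v] has eigenvalue 0 + 1 = 1 but lies in [tailv 2], where
     all weights are at least 2. *)
  rewrite (tailv_out (leqnn n) (tail n)).
  apply: (@eigenvector_tail0 x 1 2) => [j /andP[j2 jn]||].
  + by rewrite xk // (@x_weight_inj K 0) // ltnW.
  + exact: bracket_NN.
  + by rewrite right_mul_derivation wx vx /= scale0r bracket0l add0r
      bracketZr.
- move=> u k uN; rewrite bracket_N ?(tailvN (tail k.+1)) //.
  by have /tailvP[_ ->] := tail k.+1; rewrite ?scale0r.
- case=> [|[|k]] //; elim: k => [|k IHk].
    by rewrite /= right_mul_derivation vx /= !scale1r -mulr2n scaler_nat.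
  have -> : eigenframe v w k.+3 = bracket (eigenframe v w k.+2) v by [].
  rewrite right_mul_derivation IHk vx bracketZl scale1r.
  have -> : x_weight k.+3 = (x_weight k.+2 + 1)%N by rewrite addn1.
  by rewrite [in RHS]natrD [in RHS]scalerDl scale1r.
Qed.

Lemma unitriangular_basis (e' : nat -> L) : (forall k, e' k \in tailv k) ->
  (forall k, (k < n)%N -> cd k (e' k) = 1) ->
  (forall u, u \in N -> exists c : nat -> K, u = \sum_(k < n) c k *: e' k)
  /\ (forall c : nat -> K, \sum_(k < n) c k *: e' k = 0 ->
        forall k, (k < n)%N -> c k = 0).
Proof.
move=> tail diag; split.
  suff dec k u : u \in tailv k ->
      exists c : nat -> K, u = \sum_(i < n) c i *: e' i.
    by move=> u uN; apply: (dec 0%N); rewrite tailv0.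
  have [m] := ubnP (n - k); elim: m k u => // m IHm k u lt_m u_k.
  have [nk|kn] := leqP n k.
    exists (fun=> 0); rewrite (tailv_out nk u_k) big1 // => i _.
    by rewrite scale0r.
  have [||c cE] := IHm k.+1 (u - cd k u *: e' k); first by lia.
    apply: tailvS; first by rewrite rpredB ?rpredZ.
    by rewrite linearB linearZ /= diag // mulr1 subrr.
  exists (fun i => c i + (i == k)%:R * cd k u).
  rewrite -[LHS](subrK (cd k u *: e' k)) cE.
  under [RHS]eq_bigr do rewrite scalerDl; rewrite big_split; congr (_ + _).
  rewrite (bigD1 (Ordinal kn)) //= eqxx mul1r big1 ?addr0 // => i.
  by rewrite -val_eqE /= => /negPf->; rewrite mul0r scale0r.
move=> c c0 k; have [m] := ubnP k; elim: m k => // m IHm k lt_m kn.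
have /(congr1 (cd k)) := c0; rewrite linear0 linear_sum (bigD1 (Ordinal kn)) //=.
rewrite linearZ /= diag // mulr1 big1 ?addr0 // => i; rewrite -val_eqE /= => ik.
rewrite linearZ /=; have [lt_ik|ki] := ltnP i k.
  by rewrite IHm ?mul0r //; lia.
have /tailvP[_ ->] := tail i; rewrite ?mulr0 //.
by rewrite ltn_neqAle eq_sym ik.
Qed.

End Triangular.

(** * Normalisation of x, y and of the remaining products *)

Section Normalisation.
Variables (K : fieldType) (n : nat) (L : leibnizType K) (N : {vspace L}).
Variables (e : nat -> L) (x0 y0 : L).
Hypothesis n_gt2 : (2 < n)%N.
Hypothesis char0 : forall m, m.+1%:R != 0 :> K.
Hypothesis bracketN : forall u v : L, bracket u v \in N.
Hypothesis eN : forall k, e k \in N.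
Hypothesis e_dec : forall u, u \in N ->
  exists c : nat -> K, u = \sum_(k < n) c k *: e k.
Hypothesis e_free : forall c : nat -> K, \sum_(k < n) c k *: e k = 0 ->
  forall k, (k < n)%N -> c k = 0.
Hypothesis e_e0 : forall i, bracket (e i) (e 0%N) = e (next_index n i).
Hypothesis N_eS : forall u k, u \in N -> bracket u (e k.+1) = 0.
Hypothesis e_x0 : forall k, bracket (e k) x0 = (x_weight k)%:R *: e k.
Hypothesis e0_y0 : forall u c,
  u \in N -> bracket (e 0%N) (y0 - u) = c *: e 0%N -> c = 0.
Hypothesis e1_y0 : forall u c,
  u \in N -> bracket (e 1%N) (y0 - u) = c *: e 1%N -> c = 1.

Implicit Types (u v z t : L) (c d : K) (i j k : nat).

(** The vector e_3 is a square, and the elements killed by all left multiplications are stable under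
    right multiplication by e_1. *)
Lemma annr_e z k : bracket z (e k.+2) = 0.
Proof.
elim: k z => [|k IHk] z.
  have -> : e 2 = bracket (e 0%N) (e 0%N) by rewrite e_e0.
  exact: bracket_square.
have -> : e k.+3 = bracket (e k.+2) (e 0%N) by rewrite e_e0.
exact: bracket_annr.
Qed.

Lemma scale_e_eq0 k c : (k < n)%N -> c *: e k = 0 -> c = 0.
Proof.
move=> kn ck0; suff /(_ k kn) : forall i, (i < n)%N -> (i == k)%:R * c = 0.
  by rewrite eqxx mul1r.
apply: (e_free (c := fun i => (i == k)%:R * c)).
rewrite (bigD1 (Ordinal kn)) //= eqxx mul1r ck0 add0r big1 // => i.
by rewrite -val_eqE /= => /negPf->; rewrite mul0r scale0r.
Qed.

Lemma x_weight_eq0 k : ((x_weight k)%:R == 0 :> K) = (k == 1%N).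
Proof.
case: k => [|[|k]]; [exact: oner_eq0 | exact: eqxx |].
by apply: negbTE; apply: char0.
Qed.

Lemma bracket_sum_x0 (c : nat -> K) :
  bracket (\sum_(k < n) c k *: e k) x0
    = \sum_(k < n) (c k * (x_weight k)%:R) *: e k.
Proof.
by rewrite bracket_suml; apply: eq_bigr => k _; rewrite bracketZl e_x0 scalerA.
Qed.

Lemma eigenspace_x0 u (a : K) k : u \in N -> bracket u x0 = a *: u ->
  (k < n)%N -> (forall i, (i < n)%N -> i != k -> (x_weight i)%:R != a) ->
  exists c, u = c *: e k.
Proof.
move=> /e_dec[c ->]; rewrite bracket_sum_x0 => /eqP; rewrite -subr_eq0.
rewrite scaler_sumr -sumrB.
rewrite (eq_bigr (fun i : 'I_n => (c i * ((x_weight i)%:R - a)) *: e i)).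
  move=> /eqP/(e_free (c := fun i => c i * ((x_weight i)%:R - a))) c0 kn wa.
  exists (c k).
  rewrite (bigD1 (Ordinal kn)) //= big1 ?addr0 // => i.
  rewrite -val_eqE /= => ik; have /eqP := c0 i (ltn_ord i).
  rewrite mulf_eq0 subr_eq0 (negPf (wa i _ ik)) // orbF => /eqP->.
  by rewrite scale0r.
by move=> i _; rewrite scalerA -scalerBl mulrBr [a * _]mulrC.
Qed.

Lemma eigenspace_x0_0 u : u \in N -> bracket u x0 = 0 ->
  exists c, u = c *: e 1%N.
Proof.
move=> uN ux; apply: (@eigenspace_x0 u 0) => //; rewrite ?scale0r //.
  by lia.
by move=> i _ i1; rewrite x_weight_eq0.
Qed.

Lemma eigenspace_x0_1 u : u \in N -> bracket u x0 = u ->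
  exists c, u = c *: e 0%N.
Proof.
move=> uN ux; apply: (@eigenspace_x0 u 1) => //; rewrite ?scale1r //.
  by lia.
by move=> i _ i0; rewrite (@x_weight_inj K 0) ?lt0n.
Qed.

(** Right multiplication by [x0] is diagonal on N, so its square has the same kernel; equivalently,
    its image on N meets its kernel in 0. *)
Lemma ker_x0_semisimple u : u \in N -> bracket (bracket u x0) x0 = 0 ->
  bracket u x0 = 0.
Proof.
move=> /e_dec[c ->]; rewrite !bracket_sum_x0.
rewrite (bracket_sum_x0 (fun k => c k * (x_weight k)%:R)).
move/(e_free (c := fun k => c k * (x_weight k)%:R * (x_weight k)%:R)) => c0.
rewrite big1 // => k _; have /eqP := c0 k (ltn_ord k).
by rewrite -mulrA mulf_eq0 mulf_eq0 orbb -mulf_eq0 => /eqP->; rewrite scale0r.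
Qed.

(** The image and the kernel of right multiplication by [x0] split N, the kernel being the line of
    e_2. If [e_1, u] = 0, then u and hence t have no e_1-component, and t falls into the span of
    e_3, ..., e_n. *)
Lemma image_x0 u : u \in N -> exists t d, [/\ t \in N,
  u = bracket t x0 + d *: e 1%N
  & bracket (e 0%N) u = 0 -> forall z, bracket z t = 0].
Proof.
move=> /e_dec[c ->]; have n_gt1 : (1 < n)%N by lia.
have n_gt0 : (0 < n)%N by lia.
(* The weight of e_2 is 0 and division by 0 gives 0, so t has no e_2-component. *)
exists (\sum_(k < n) (c k / (x_weight k)%:R) *: e k), (c 1%N); split.
- by apply: rpred_sum => k _; apply: rpredZ.
- rewrite (bracket_sum_x0 (fun k => c k / (x_weight k)%:R)).
  rewrite (bigD1 (Ordinal n_gt1)) //= [in RHS](bigD1 (Ordinal n_gt1)) //=.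
  rewrite mulr0 scale0r add0r addrC; congr (_ + _); apply: eq_bigr => k.
  by rewrite -val_eqE /= => k1; rewrite divfK // x_weight_eq0.
rewrite bracket_sumr (bigD1 (Ordinal n_gt0)) //= bracketZr e_e0 big1 ?addr0.
  move=> /(scale_e_eq0 n_gt2) c0 z; rewrite bracket_sumr.
  rewrite big1 // => -[k kn] _ /=; rewrite bracketZr; case: k kn => [|[|k]] kn /=.
  - by rewrite c0 mul0r scale0r.
  - by rewrite invr0 mulr0 scale0r.
  by rewrite annr_e scaler0.
by case=> [[|k] kn] // _; rewrite bracketZr N_eS // scaler0.
Qed.

(** The corrections of [x0] and [y0] leave the products as eigenvectors of right multiplication by
    [x0], hence as scalar multiples of a single e_i; Leibniz identities then determine every scalar
    except q. *)
Lemma normal_form : exists x y q, [/\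
  x0 - x \in N /\ y0 - y \in N, q = 0 \/ q = -1,
  [/\ forall k, bracket (e k) x = (x_weight k)%:R *: e k,
      bracket (e 0%N) y = 0, bracket (e 1%N) y = e 1%N
    & forall k, bracket (e k.+2) y = 0],
  [/\ bracket x (e 0%N) = - e 0%N, bracket x (e 1%N) = 0,
      bracket y (e 0%N) = 0 & bracket y (e 1%N) = q *: e 1%N]
  & [/\ bracket x x = 0, bracket x y = 0, bracket y x = 0 & bracket y y = 0]].
Proof.
have n_gt0 : (0 < n)%N by lia.
have n_gt1 : (1 < n)%N by lia.
have Ne1 u : u \in N -> bracket u (e 1%N) = 0 by apply: N_eS.
have [s [d [sN y0x _]]] := image_x0 (bracketN y0 x0).
pose y1 := y0 - s.
have y1x : bracket y1 x0 = d *: e 1%N by rewrite bracketBl y0x addrC addKr.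
(* [u, [y1, x0]] is a multiple of [u, e_2] = 0, so the right multiplications by [y1] and [x0]
   commute on N and [y1] preserves the eigenlines. *)
have comm u : u \in N -> bracket (bracket u y1) x0 = bracket (bracket u x0) y1.
  move=> uN; apply/eqP; rewrite -subr_eq0 -leibniz_identity y1x bracketZr.
  by rewrite Ne1 // scaler0.
have e0y : bracket (e 0%N) y1 = 0.
  have [|c cE] := eigenspace_x0_1 (bracketN (e 0%N) y1).
    by rewrite comm // e_x0 scale1r.
  by rewrite cE (e0_y0 sN cE) scale0r.
have e1y : bracket (e 1%N) y1 = e 1%N.
  have [|c cE] := eigenspace_x0_0 (bracketN (e 1%N) y1).
    by rewrite comm // e_x0 scale0r bracket0l.
  by rewrite cE (e1_y0 sN cE) scale1r.
have eky k : bracket (e k.+2) y1 = 0.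
  elim: k => [|k IHk].
    have -> : e 2 = bracket (e 0%N) (e 0%N) by rewrite e_e0.
    by rewrite right_mul_derivation e0y bracket0l bracket0r addr0.
  have -> : e k.+3 = bracket (e k.+2) (e 0%N) by rewrite e_e0.
  by rewrite right_mul_derivation e0y IHk bracket0l bracket0r addr0.
(* [e_1, [x0, x0]] = 0, so t is killed by all left multiplications: subtracting it from [x0] changes
   no right multiplication. *)
have [t [c1 [tN xx]]] := image_x0 (bracketN x0 x0).
move=> /(_ (bracket_square _ _)) tann; pose x1 := x0 - t.
have Rx1 u : bracket u x1 = bracket u x0 by rewrite bracketBr tann subr0.
have {xx} x1x1 : bracket x1 x1 = c1 *: e 1%N.
  by rewrite Rx1 bracketBl xx addrC addKr.
have x1e1 : bracket x1 (e 1%N) = 0.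
  have [|p pE] := eigenspace_x0_0 (bracketN x1 (e 1%N)).
    rewrite -Rx1 right_mul_derivation x1x1 bracketZl Ne1 // Rx1 e_x0.
    by rewrite scaler0 scale0r bracket0r addr0.
  (* The Leibniz identity for (x1, x1, e_2) gives p^2 = 0. *)
  have : p *: (p *: e 1%N) = 0.
    rewrite -pE -bracketZr -pE leibniz_identity x1x1 bracketZl Ne1 // pE.
    by rewrite bracketZl Rx1 e_x0 scale0r !scaler0 subr0.
  rewrite scalerA => /(scale_e_eq0 n_gt1) /eqP.
  rewrite mulf_eq0 orbb => /eqP p0.
  by rewrite pE p0 scale0r.
have y1x1 : bracket y1 x1 = d *: e 1%N by rewrite Rx1.
have x1y1x : bracket (bracket x1 y1) x0 = c1 *: e 1%N.
  rewrite -Rx1 right_mul_derivation x1x1 y1x1 bracketZl bracketZr e1y x1e1.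
  by rewrite scaler0 addr0.
(* By the previous identity c1 e_2 is in the image of right multiplication by [x0] on N, and it is
   also in the kernel. *)
have c1_0 : c1 *: e 1%N = 0.
  rewrite -x1y1x ker_x0_semisimple // x1y1x bracketZl e_x0.
  by rewrite scale0r scaler0.
rewrite c1_0 in x1x1 x1y1x.
have [r x1y1] := eigenspace_x0_0 (bracketN x1 y1) x1y1x.
have [|q y1e1] := eigenspace_x0_0 (bracketN y1 (e 1%N)).
  rewrite -Rx1 right_mul_derivation y1x1 bracketZl Ne1 // Rx1 e_x0.
  by rewrite scaler0 scale0r bracket0r addr0.
(* The Leibniz identity for (y1, y1, e_2) reads q^2 e_2 = - q e_2. *)
have q01 : q = 0 \/ q = -1.
  have : q *: (q *: e 1%N) = - (q *: e 1%N).
    rewrite -{1}y1e1 -bracketZr -y1e1 leibniz_identity Ne1 // y1e1 sub0r.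
    by rewrite bracketZl e1y.
  rewrite scalerA => /eqP; rewrite -addr_eq0 -scalerDl => /eqP.
  move=> /(scale_e_eq0 n_gt1)/eqP.
  rewrite -{3}[q]mulr1 -mulrDr mulf_eq0 addr_eq0.
  by case/orP=> /eqP; [left | right].
(* Since [e_2, y1] = e_2, subtracting r e_2 cancels [x1, y1] = r e_2. *)
pose x := x1 - r *: e 1%N.
have Rx u : u \in N -> bracket u x = bracket u x0.
  by move=> uN; rewrite bracketBr bracketZr Ne1 // scaler0 subr0.
have xe1 : bracket x (e 1%N) = 0.
  by rewrite bracketBl x1e1 bracketZl Ne1 // scaler0 subr0.
have xy1 : bracket x y1 = 0 by rewrite bracketBl x1y1 bracketZl e1y subrr.
have xx : bracket x x = 0.
  rewrite bracketBl bracketBr x1x1 bracketZr x1e1 bracketZl Rx // e_x0.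
  by rewrite scale0r !scaler0 !subr0.
have [c y1x'] : exists c, bracket y1 x = c *: e 1%N.
  exists (d - r * q).
  by rewrite bracketBr y1x1 bracketZr y1e1 scalerA scalerBl.
have y1y1x : bracket (bracket y1 y1) x = c *: e 1%N.
  have := leibniz_identity y1 x y1; rewrite xy1 bracket0r y1x' bracketZl e1y.
  by move/esym/eqP; rewrite subr_eq0 => /eqP.
(* Again image and kernel meet in 0: the Leibniz identity for (y1, x, y1) has just exhibited c e_2
   as [[y1, y1], x]. *)
have c0 : c *: e 1%N = 0.
  rewrite -y1y1x Rx // ker_x0_semisimple //.
  rewrite -[bracket (bracket y1 y1) x0]Rx // y1y1x bracketZl e_x0.
  by rewrite scale0r scaler0.
rewrite {}c0 in y1x' y1y1x.
have [|s' y1y1] := eigenspace_x0_0 (bracketN y1 y1); first by rewrite -Rx.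
(* From [y1, [y1, y1]] = 0. This makes the correction by s' e_2 cancel [y1, y1]: of the two cross
   terms, [y1, s' e_2] vanishes and [s' e_2, y1] is s' e_2. *)
have s'q : s' *: (q *: e 1%N) = 0.
  by rewrite -y1e1 -bracketZr -y1y1 bracket_square.
pose y := y1 - s' *: e 1%N.
have Ry u : u \in N -> bracket u y = bracket u y1.
  by move=> uN; rewrite bracketBr bracketZr Ne1 // scaler0 subr0.
have xy : bracket x y = 0.
  by rewrite bracketBr xy1 bracketZr xe1 scaler0 subr0.
have yx : bracket y x = 0.
  by rewrite bracketBl y1x' bracketZl Rx // e_x0 scale0r scaler0 subr0.
have yy : bracket y y = 0.
  rewrite bracketBl bracketZl [bracket (e 1%N) y]Ry // e1y.
  by rewrite bracketBr y1y1 bracketZr y1e1 s'q subr0 subrr.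
have ye1 : bracket y (e 1%N) = q *: e 1%N.
  by rewrite bracketBl bracketZl (Ne1 (e 1%N)) // scaler0 subr0.
have e2_neq0 p : p *: e 2 = 0 -> p = 0 by apply: scale_e_eq0.
have e0x : bracket (e 0%N) x = e 0%N by rewrite Rx // e_x0 scale1r.
have xe0 : bracket x (e 0%N) = - e 0%N.
  have [|p pE] := eigenspace_x0_1 (bracketN x (e 0%N)).
    by rewrite -Rx // right_mul_derivation xx bracket0l add0r e0x.
  (* The symmetrised product (p + 1) e_1 is killed by left multiplication by e_1, so (p + 1) e_3 =
     0. *)
  have := bracket_symm (e 0%N) x (e 0%N); rewrite pE e0x bracketDr bracketZr.
  rewrite e_e0 /= -[X in _ + X]scale1r -scalerDl => /e2_neq0/eqP.
  by rewrite addr_eq0 => /eqP->; rewrite scaleN1r.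
have e0y' : bracket (e 0%N) y = 0 by rewrite Ry.
have ye0 : bracket y (e 0%N) = 0.
  have [|p pE] := eigenspace_x0_1 (bracketN y (e 0%N)).
    by rewrite -Rx // right_mul_derivation yx bracket0l add0r e0x.
  have := bracket_symm (e 0%N) y (e 0%N); rewrite pE e0y' addr0 bracketZr.
  by rewrite e_e0 => /e2_neq0->; rewrite scale0r.
exists x, y, q; split=> //.
- by rewrite /x /x1 /y /y1; split;
    rewrite !opprB addrC addrA subrK rpredD ?rpredZ.
by split=> [k|//||k]; rewrite ?Rx ?Ry.
Qed.

End Normalisation.

(** * Isomorphisms with the algebras given by tables *)

Lemma isomorphic_of_bijection (K : fieldType) (A B : leibnizType K)
    (g : 'Hom(A, B)) : lker g = 0%VS -> limg g = fullv ->
  (forall u v, g (bracket u v) = bracket (g u) (g v)) -> isomorphic B A.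
Proof.
move=> g_inj g_im gM.
have gK : cancel g (g^-1)%VF by apply/lker0_lfunK/eqP.
have invK u : g ((g^-1)%VF u) = u by rewrite limg_lfunVK // g_im memvf.
exists (g^-1)%VF; split=> [||u v].
- apply/eqP; rewrite -subv0; apply/subvP=> u; rewrite memv_ker => /eqP u0.
  by rewrite -[u]invK u0 linear0 mem0v.
- apply/eqP; rewrite eqEsubv subvf; apply/subvP=> u _.
  by rewrite -[u]gK memv_img ?memvf.
by rewrite -{1}[u]invK -{1}[v]invK -gM gK.
Qed.

(** The maps constructed below start from the coordinate space. Equal dimensions make a surjection
    bijective, and its inverse has the required direction. *)
Lemma isomorphic_of_surjection (K : fieldType) (A L : leibnizType K)
    (g : 'Hom(A, L)) :
  \dim (fullv : {vspace L}) = \dim (fullv : {vspace A}) ->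
  (forall z, exists u, z = g u) ->
  (forall u v, g (bracket u v) = bracket (g u) (g v)) -> isomorphic L A.
Proof.
move=> dimL g_surj gM.
have g_im : limg g = fullv.
  apply/eqP; rewrite eqEsubv subvf; apply/subvP=> z _.
  by have [u ->] := g_surj z; rewrite memv_img ?memvf.
apply: (isomorphic_of_bijection (g := g)) => //.
have := limg_ker_dim g fullv; rewrite g_im capfv -dimL -[RHS]add0n.
by move/addIn/eqP; rewrite dimv_eq0 => /eqP.
Qed.

Section TableIsomorphism.
Variables (K : fieldType) (n : nat) (L : leibnizType K) (B : label -> L).
Hypothesis B_out : forall a, ~~ is_basis_label n n.+2 a -> B a = 0.

(** The linear extension of [B]. As [B] vanishes on labels outside the basis, tables can be compared
    on all labels at once. *)
Definition table_map (u : 'rV[K]_n.+2) : L :=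
  \sum_i u 0 i *: B (basis_label n i).

Lemma table_map_is_linear : linear table_map.
Proof.
move=> c u v; rewrite /table_map scaler_sumr -big_split; apply: eq_bigr => i _.
by rewrite !mxE scalerDl scalerA.
Qed.

HB.instance Definition _ :=
  GRing.isLinear.Build K 'rV[K]_n.+2 L _ table_map table_map_is_linear.

Lemma table_map_bvec a : table_map (bvec K n n.+2 a) = B a.
Proof.
have [/is_basis_labelP[i <-]|aN] := boolP (is_basis_label n n.+2 a); last first.
  by rewrite B_out // bvec0 // linear0.
rewrite bvec_delta // /table_map (bigD1 i) //= mxE !eqxx scale1r.
by rewrite big1 ?addr0 // => j ji; rewrite mxE (negPf ji) andbF scale0r.
Qed.

Lemma table_map_bracket T u v :
  (forall a b, bracket (B a) (B b) = table_map (T a b)) ->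
  table_map (table_bracket n T u v) = bracket (table_map u) (table_map v).
Proof.
move=> BT; rewrite /table_bracket linear_sum [table_map u]/table_map.
rewrite bracket_suml; apply: eq_bigr => i _; rewrite linear_sum.
rewrite bracketZl [table_map v]/table_map bracket_sumr scaler_sumr.
by apply: eq_bigr => j _; rewrite linearZ /= -BT bracketZr scalerA.
Qed.

End TableIsomorphism.

Section NormalFormIsomorphism.
Variables (K : fieldType) (n : nat) (L : leibnizType K).
Variables (e : nat -> L) (x y : L) (q : K).
Hypothesis n_gt2 : (2 < n)%N.
Hypothesis dimL : \dim (fullv : {vspace L}) = n.+2.
Hypothesis e_out : forall k, (n <= k)%N -> e k = 0.
Hypothesis e_e0 : forall i, bracket (e i) (e 0%N) = e (next_index n i).
Hypothesis e_e1 : forall i, bracket (e i) (e 1%N) = 0.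
Hypothesis annr_e : forall z k, bracket z (e k.+2) = 0.
Hypothesis e_x : forall k, bracket (e k) x = (x_weight k)%:R *: e k.
Hypothesis e0_y : bracket (e 0%N) y = 0.
Hypothesis e1_y : bracket (e 1%N) y = e 1%N.
Hypothesis e_y : forall k, bracket (e k.+2) y = 0.
Hypothesis x_e0 : bracket x (e 0%N) = - e 0%N.
Hypothesis x_e1 : bracket x (e 1%N) = 0.
Hypothesis y_e0 : bracket y (e 0%N) = 0.
Hypothesis y_e1 : bracket y (e 1%N) = q *: e 1%N.
Hypothesis xx : bracket x x = 0.
Hypothesis xy : bracket x y = 0.
Hypothesis yx : bracket y x = 0.
Hypothesis yy : bracket y y = 0.
Hypothesis L_dec : forall z, exists (c : nat -> K) (a b : K),
  z = \sum_(k < n) c k *: e k + a *: x + b *: y.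

(** Labels count the e_i from 1, the sequence [e] from 0; the label with index 0 names no vector. *)
Definition frame_label (a : label) : L :=
  match a with
  | inl 0 => 0 | inl k.+1 => e k | inr true => x | inr false => y
  end.

Lemma frame_label_out a : ~~ is_basis_label n n.+2 a -> frame_label a = 0.
Proof.
case: a => [[|k]|[]] //=; rewrite ?ltnSn ?leqnSn //= => kn.
by apply: e_out; lia.
Qed.

Local Notation g := (table_map (n := n) frame_label).

Let gb a : g (bvec K n n.+2 a) = frame_label a.
Proof. exact: table_map_bvec frame_label_out a. Qed.

Lemma frame_surj z : exists u, z = g u.
Proof.
have [c [a [b ->]]] := L_dec z.
exists (\sum_(k < n) c k *: bvec K n n.+2 (inl k.+1)
        + a *: bvec K n n.+2 (inr true) + b *: bvec K n n.+2 (inr false)).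
rewrite !linearD !linearZ /= !gb linear_sum; congr (_ + _ + _).
by apply: eq_bigr => k _; rewrite linearZ /= gb.
Qed.

Lemma frame_step k : e k.+3 = g (if (3 <= k.+3 <= n - 1)%N
   then bvec K n n.+2 (inl k.+4) else 0).
Proof.
by case: ifP => [_|kn]; rewrite ?gb // linear0 e_out //; lia.
Qed.

Lemma frame_x k : (x_weight k.+2)%:R *: e k.+2 = g (if (3 <= k.+3 <= n)%N
   then (k.+3 - 1)%:R *: bvec K n n.+2 (inl k.+3) else 0).
Proof.
case: ifP => [_|kn]; first by rewrite linearZ /= gb subn1.
by rewrite linear0 e_out ?scaler0 //; lia.
Qed.

Lemma L1_of_frame : q = -1 -> isomorphic L (L1 K n).
Proof.
move=> q1; pose gl : {linear L1 K n -> L} := g.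
have gE u : linfun gl u = g u by rewrite lfunE.
apply: (isomorphic_of_surjection (g := linfun gl)).
- by rewrite dimL dimvf /dim /= mul1n.
- by move=> z; have [u ->] := frame_surj z; exists u.
move=> u v; rewrite !gE; apply: table_map_bracket => a b.
case: b => [[|[|[|b]]]|[]]; case: a => [[|[|[|a]]]|[]] /=;
 rewrite ?bracket0l ?bracket0r ?annr_e ?linear0 //.
- by rewrite e_e0 gb.
- by rewrite e_e0 e_out.
- by rewrite e_e0; apply: frame_step.
- by rewrite linearN /= gb.
- by rewrite linearN /= gb y_e1 q1 scaleN1r.
- by rewrite e_x /= scale1r gb.
- by rewrite e_x /= scale0r.
- by rewrite e_x; apply: frame_x.
- by rewrite gb.
Qed.

Lemma L2_of_frame : q = 0 -> isomorphic L (L2 K n).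
Proof.
move=> q0; pose gl : {linear L2 K n -> L} := g.
have gE u : linfun gl u = g u by rewrite lfunE.
apply: (isomorphic_of_surjection (g := linfun gl)).
- by rewrite dimL dimvf /dim /= mul1n.
- by move=> z; have [u ->] := frame_surj z; exists u.
move=> u v; rewrite !gE; apply: table_map_bracket => a b.
case: b => [[|[|[|b]]]|[]]; case: a => [[|[|[|a]]]|[]] /=;
  rewrite ?bracket0l ?bracket0r ?annr_e ?linear0 //.
- by rewrite e_e0 gb.
- by rewrite e_e0 e_out.
- by rewrite e_e0; apply: frame_step.
- by rewrite linearN /= gb.
- by rewrite y_e1 q0 scale0r.
- by rewrite e_x /= scale1r gb.
- by rewrite e_x /= scale0r.
- by rewrite e_x; apply: frame_x.
- by rewrite gb.
Qed.

End NormalFormIsomorphism.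

(** * The two algebras are not isomorphic *)

Section NotIsomorphic.
Variables (K : fieldType) (n : nat).
Hypothesis n_gt2 : (2 < n)%N.

Local Notation bv := (bvec K n n.+2).
Local Notation T1 := (L1_table K n n.+2).
Local Notation T2 := (L2_table K n n.+2).
Local Notation E i := (inl i%N).
Local Notation X := (inr true).
Local Notation Y := (inr false).

Definition ord_e2 : 'I_n.+2 := Ordinal (isT : 1 < n.+2)%N.
Definition ord_y : 'I_n.+2 := ord_max.

Lemma ord_e2_label : basis_label n ord_e2 = E 2.
Proof. by rewrite /basis_label /= ltnW. Qed.

Lemma ord_y_label : basis_label n ord_y = Y.
Proof. by rewrite /basis_label /= ltnNge leqnSn /= (gtn_eqF (ltnSn n)). Qed.

Lemma bvec_e2 a : bv a 0 ord_e2 = (a == E 2)%:R.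
Proof. by rewrite mxE ord_e2_label eq_sym. Qed.

Lemma bvec_y a : bv a 0 ord_y = (a == Y)%:R.
Proof. by rewrite mxE ord_y_label eq_sym. Qed.

(** The only entry of the table of L_2 with an e_2-component is [e_2, y] = e_2. *)
Lemma L2_bracket_e2 (u v : L2 K n) :
  bracket u v 0 ord_e2 = u 0 ord_e2 * v 0 ord_y.
Proof.
have T2E a b : T2 a b 0 ord_e2 = ((a == E 2) && (b == Y))%:R.
  by case: b => [[|[|[|b]]]|[]]; case: a => [[|[|[|a]]]|[]] //=;
    do ?case: ifP => // ?; rewrite ?mxE ?ord_e2_label //= ?mulr0 ?oppr0.
rewrite -[bracket u v]/(table_bracket n T2 u v) /table_bracket summxE.
rewrite (bigD1 ord_e2) //=.
rewrite summxE (bigD1 ord_y) //= mxE T2E ord_e2_label ord_y_label !eqxx mulr1.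
rewrite !big1 ?addr0 // => i i_ne.
  rewrite summxE big1 // => j _; rewrite mxE T2E.
  rewrite -ord_e2_label (inj_eq (@basis_label_inj _ _ (leqnn _))).
  by rewrite (negPf i_ne) mulr0.
rewrite mxE T2E -ord_y_label (inj_eq (@basis_label_inj _ _ (leqnn _))).
by rewrite (negPf i_ne) andbF mulr0.
Qed.

Lemma L2_bracket_y (u v : L2 K n) : bracket u v 0 ord_y = 0.
Proof.
have T2E a b : T2 a b 0 ord_y = 0.
  by case: b => [[|[|[|b]]]|[]]; case: a => [[|[|[|a]]]|[]] //=;
    do ?case: ifP => // ?; rewrite ?mxE ?ord_y_label //= ?mulr0 ?oppr0.
rewrite -[bracket u v]/(table_bracket n T2 u v) summxE big1 // => i _.
by rewrite summxE big1 // => j _; rewrite mxE T2E mulr0.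
Qed.

(* Through an isomorphism f, the coordinate along e_2 of L_2 vanishes on
   [L_1, L_1], although it does not vanish on [L_2, L_2]: e_2 = [e_2, y]. *)
Lemma L1_not_isomorphic_L2 : ~ isomorphic (L1 K n) (L2 K n).
Proof.
have l1 : is_basis_label n n.+2 (E 1) by move=> /=; lia.
have l2 : is_basis_label n n.+2 (E 2) by move=> /=; lia.
have lX : is_basis_label n n.+2 X by move=> /=; lia.
have lY : is_basis_label n n.+2 Y by move=> /=; lia.
case=> f [_ f_im fM].
pose lam u : K := f u 0 ord_e2.
have lamM u v : lam (bracket u v) = lam u * f v 0 ord_y.
  by rewrite /lam fM L2_bracket_e2.
have lamN u : lam (- u) = - lam u by rewrite /lam linearN mxE.
have lamZ c u : lam (c *: u) = c * lam u by rewrite /lam linearZ mxE.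
have lam0 : lam 0 = 0 by rewrite /lam linear0 mxE.
have T1E a b : is_basis_label n n.+2 a -> is_basis_label n n.+2 b ->
    T1 a b = bracket (bv a : L1 K n) (bv b : L1 K n).
  by move=> ha hb; rewrite [bracket _ _]table_bvecE // ha hb.
have e1_y : f (bv (E 1)) 0 ord_y = 0.
  have -> : bv (E 1) = T1 (E 1) X by [].
  by rewrite T1E // fM L2_bracket_y.
have e2_y : f (bv (E 2)) 0 ord_y = 0.
  have -> : bv (E 2) = T1 (E 2) Y by [].
  by rewrite T1E // fM L2_bracket_y.
(* In L_1 every e_i is, up to sign, a product with right factor e_1 or e_2. The images of these two
   factors have no y-coordinate, so [lamM] makes [lam] vanish on such products. *)
have lam_e k : lam (bv (E k)) = 0.
  have [kn|kN] := boolP (is_basis_label n n.+2 (E k)); last by rewrite bvec0.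
  case: k kn => [|[|[|k]]] kn //.
  - have -> : bv (E 1) = - T1 X (E 1) by rewrite opprK.
    by rewrite lamN T1E // lamM e1_y mulr0 oppr0.
  - have -> : bv (E 2) = - T1 Y (E 2) by rewrite opprK.
    by rewrite lamN T1E // lamM e2_y mulr0 oppr0.
  have [a ha ->] : exists2 a, is_basis_label n n.+2 a
      & bv (E k.+3) = T1 a (E 1).
    case: k kn => [|k] kn; first by exists (E 1).
    exists (E k.+3); first by move: kn => /= /andP[/ltnW-> /ltnW->].
    by rewrite /= ifT //; case/andP: kn => kn _;
      rewrite -ltnS subn1 prednK // (leq_trans _ kn).
  by rewrite T1E // lamM e1_y mulr0.
have lam_T a b : lam (T1 a b) = 0.
  by case: b => [[|[|[|b]]]|[]]; case: a => [[|[|[|a]]]|[]] //=;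
    do ?case: ifP => //; rewrite ?lamN ?lamZ ?lam_e ?lam0 ?mulr0 ?oppr0.
have lam_bracket (u v : L1 K n) : lam (bracket u v) = 0.
  rewrite /lam -[bracket u v]/(table_bracket n T1 u v) linear_sum.
  rewrite summxE big1 // => i _; rewrite linear_sum summxE big1 // => j _; rewrite linearZ mxE.
  by rewrite [X in _ * X]lam_T mulr0.
have surj v : exists u, f u = v.
  have : v \in limg f by rewrite f_im memvf.
  by case/memv_imgP=> u _ ->; exists u.
have [u fu] := surj (bv (E 2)); have [v fv] := surj (bv Y).
have /eqP := lam_bracket u v.
by rewrite lamM /lam fu fv bvec_e2 bvec_y !eqxx mulr1 oner_eq0.
Qed.

End NotIsomorphic.

(** * Assembly of the classification *)

Lemma classification (K : fieldType) (n : nat) (L : leibnizType K)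
    (N : {vspace L}) :
  (2 < n)%N -> (forall m, m.+1%:R != 0 :> K) ->
  \dim (fullv : {vspace L}) = n.+2 -> is_solvable (fullv : {vspace L}) ->
  is_nilradical N -> isomorphic_onto (F2 K n) N ->
  isomorphic L (L1 K n) \/ isomorphic L (L2 K n).
Proof.
move=> n_gt2 char0 dimL solL nilN isoN.
have N_ideal : is_ideal N by case: nilN.
have dimN : \dim N = n.
  case: isoN => f [f_inj <- _].
  by rewrite limg_dim_eq ?f_inj ?capv0 // dimvf /dim /= mul1n.
have [e [cd [[eN e_out] cd_e e_dec e_e0 N_eS]]] := F2_frame n_gt2 isoN.
have [x0 [y0 [wx [wy0 wy1] bracketN L_dec]]] :=
  weight_basis n_gt2 N_ideal eN e_out cd_e e_dec e_e0 N_eS dimN dimL solL nilN.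
have [e' [[tail diag] e'_e0 N_e'S e'_x]] :=
  eigenframe_ex n_gt2 N_ideal eN e_out cd_e e_dec e_e0 N_eS char0 wx.
have [e'_dec e'_free] := unitriangular_basis n_gt2 eN cd_e e_dec tail diag.
have e'N k : e' k \in N by have /(tailvP n_gt2 eN cd_e e_dec)[] := tail k.
have e'_out k : (n <= k)%N -> e' k = 0.
  by move=> nk; apply: (tailv_out n_gt2 eN cd_e e_dec nk).
(* Since [e' k] has leading coordinate 1 in the flag, the eigenvalue is the weight of [y0 - u], and
   u in N has zero weights. *)
have eigen_y k u c : (k < n)%N -> u \in N ->
    bracket (e' k) (y0 - u) = c *: e' k -> c = weight e cd y0 k.
  move=> kn uN yE.
  have [_] := triangular n_gt2 N_ideal eN e_out cd_e e_dec e_e0 N_eS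
    (y0 - u) kn (tail k).
  rewrite yE linearZ /= diag // mulr1 mul1r => ->.
  rewrite addrC -scaleN1r weight_is_linear.
  by rewrite (weight_N n_gt2 N_ideal eN e_out cd_e e_dec e_e0 N_eS uN kn)
    mulr0 add0r.
have e0_y u c : u \in N -> bracket (e' 0%N) (y0 - u) = c *: e' 0%N -> c = 0.
  by move=> uN yE; rewrite (eigen_y 0%N u c) //; lia.
have e1_y u c : u \in N -> bracket (e' 1%N) (y0 - u) = c *: e' 1%N -> c = 1.
  by move=> uN yE; rewrite (eigen_y 1%N u c) //; lia.
have [x [y [q [[x0x y0y] q01 [e_x e0y e1y eky]
    [xe0 xe1 ye0 ye1] [xx xy yx yy]]]]] :=
  normal_form n_gt2 char0 bracketN e'N e'_dec e'_free e'_e0 N_e'S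
    e'_x e0_y e1_y.
have annr z k : bracket z (e' k.+2) = 0 by apply: annr_e e'_e0 z k.
have e_e1 i : bracket (e' i) (e' 1%N) = 0 by apply: N_e'S.
have dec z : exists (c : nat -> K) (a b : K),
    z = \sum_(k < n) c k *: e' k + a *: x + b *: y.
  have [a [b zN]] := L_dec z.
  have [|c cE] := e'_dec (z - a *: x - b *: y).
    have -> : z - a *: x - b *: y
        = z - a *: x0 - b *: y0 + a *: (x0 - x) + b *: (y0 - y).
      by rewrite !scalerBr [X in _ = X + _]addrAC !subrKA.
    by rewrite rpredD ?rpredZ // rpredD ?rpredZ.
  exists c, a, b; by rewrite -cE [X in _ = X + _]addrAC !subrK.
case: q01 => q_val; [right | left].
  exact: (@L2_of_frame K n L e' x y q).
exact: (@L1_of_frame K n L e' x y q).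
Qed.

Theorem theorem4p8 (R : realType) (n : nat) (n_ge3 : (3 <= n)%N) :
  (forall L : leibnizType R[i],
     \dim (fullv : {vspace L}) = n.+2 ->
     is_solvable (fullv : {vspace L}) ->
     (exists N : {vspace L}, is_nilradical N /\ isomorphic_onto (F2 R[i] n) N) ->
     isomorphic L (L1 R[i] n) \/ isomorphic L (L2 R[i] n))
  /\ ~ isomorphic (L1 R[i] n) (L2 R[i] n).
Proof.
split=> [L dimL solL [N [nilN isoN]]|]; last exact: L1_not_isomorphic_L2.
apply: (classification n_ge3 _ dimL solL nilN isoN) => m.
by rewrite Num.Theory.pnatr_eq0.
Qed.
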